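(* Let $N\ge 1$ be an integer, let $a,b>0$ with $ab<1$, let $n\ge 3$ be an odd integer with $n>\frac2a+1$, and let $g=s_N$ be the $N$th order B-spline. Then the finite Gram matrix $G_n\in\mathbb{C}^{n^2\times n^2}$ with entries $(G_n)_{(j,k),(j',k')}=\langle g_{j,k},g_{j',k'}\rangle$, $j,j',k,k'\in\mathcal{I}_n$, viewed as an $n\times n$ block matrix indexed by the modulation indices $j,j'$ with $n\times n$ blocks, is block-Toeplitz, and its blocks are banded.
   Context: B-splines: $s_1=\chi_{[-1/2,1/2]}$ and $s_N=s_1*s_{N-1}$ for $N\ge 2$. Index set: $\mathcal{I}_n=\{-\frac{n-1}{2},\dots,\frac{n-1}{2}\}$. Atoms: $g_{j,k}(x)=g(x-ka)e^{2\pi i jbx}$. Inner product: $\langle f,h\rangle=\int_{\mathbb{R}}f\,\overline{h}\,dx$. The $(j,j')$ block of $G_n$ is the $n\times n$ matrix $G_n^{(j,j')}$ with entries $(G_n^{(j,j')})_{k,k'}=\langle g_{j,k},g_{j',k'}\rangle$, $k,k'\in\mathcal{I}_n$. A Hermitian block matrix is block-Toeplitz if its $(j,j')$ block depends only on $j-j'$ (so, writing $A^{[\ell]}$ for the block with $j-j'=\ell$, $A^{[\ell]}=(A^{[-\ell]})^*$). Here a block is called banded if its $(k,k')$ entry is zero whenever $|k-k'|>\frac{N}{a}$. *)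

(* Defs.v *)
From HB Require Import structures.
From mathcomp Require Import all_boot all_order all_algebra.
From mathcomp Require Import complex.
From mathcomp Require Import all_classical all_reals all_analysis.
Import Order.TTheory GRing.Theory Num.Theory.
Import numFieldNormedType.Exports.

Set Implicit Arguments.
Unset Strict Implicit.
Unset Printing Implicit Defensive.

Local Open Scope classical_set_scope.
Local Open Scope ring_scope.
Local Open Scope complex_scope.

Section Gabor.
Variable R : realType.

Definition convolution (f h : R -> R) (x : R) : R :=
  (\int[lebesgue_measure]_(t in [set: R]) (f t * h (x - t)))%R.

Definition box : R -> R := \1_`[- 2^-1, 2^-1].

(* [bspline N] is $s_N$ for N >= 1; the value at N = 0 is junk ([box]). *)
Definition bspline (N : nat) : R -> R := iter N.-1 (convolution box) box.

(* $e^{it}$ *)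
Definition expi (t : R) : R[i] := cos t +i* sin t.

Definition cintegral (f : R -> R[i]) : R[i] :=
  (\int[lebesgue_measure]_(x in [set: R]) complex.Re (f x))%R +i*
  (\int[lebesgue_measure]_(x in [set: R]) complex.Im (f x))%R.

Definition inner (f h : R -> R[i]) : R[i] := cintegral (fun x => f x * (h x)^*).

(* The elements of $\mathcal I_n$ in increasing order: $-(n-1)/2 + i$, i < n.
   They are half-integers for even n, hence the values in R. *)
Definition cidx (n : nat) (i : 'I_n) : R := i%:R - (n%:R - 1) / 2.

(* Here j and k are the actual (real) values of the indices, not positions. *)
Definition atom (g : R -> R) (a b j k : R) (x : R) : R[i] :=
  (g (x - k * a))%:C * expi (2 * pi * j * b * x).

(* Modulation indices j, j' label the blocks; translation indices k, k' label
   the entries of each block. The size \sum_(j < n) n is n ^ 2. *)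
Definition gram (n : nat) (g : R -> R) (a b : R) : 'M[R[i]]_(\sum_(j < n) n) :=
  \mxblock_(j < n, j' < n) \matrix_(k < n, k' < n)
    inner (atom g a b (cidx j) (cidx k)) (atom g a b (cidx j') (cidx k')).

Definition block_toeplitz (n m : nat) (A : 'M[R[i]]_(\sum_(j < n) m)) : Prop :=
  A \is hermsymmx /\
  exists T : R -> 'M[R[i]]_m, forall j j' : 'I_n,
    submxblock A j j' = T (cidx j - cidx j').

Definition banded (m : nat) (w : R) (B : 'M[R[i]]_m) : Prop :=
  forall k k' : 'I_m, w < `|cidx k - cidx k'| -> B k k' = 0.

End Gabor.

(* Main.v *)
Require Import Defs.
From HB Require Import structures.
From mathcomp Require Import all_boot all_order all_algebra.
From mathcomp Require Import complex.
From mathcomp Require Import all_classical all_reals all_analysis.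
From mathcomp Require Import ring lra.
Import Order.TTheory GRing.Theory Num.Theory.
Import numFieldNormedType.Exports.
Local Open Scope ring_scope.

(* The modulations in $\langle g_{j,k}, g_{j',k'}\rangle$ combine pointwise into
   $e^{2\pi i(j-j')bx}$, so an entry depends on $j, j'$ through $j-j'$ only. As
   $s_N$ vanishes off $[-N/2, N/2]$, the integrand is identically zero once the
   translates are more than $N$ apart, i.e. $|k-k'|a > N$. *)

(* No integrability is needed: [fine] sends both infinities to [0], so the
   junk values of the two sides agree as well. *)
Lemma fine_sub_opp (R : realType) (x y : \bar R) :
  fine (x - y)%E = - fine (y - x)%E.
Proof. by case: x y => [x| |] [y| |] //=; rewrite ?oppr0 ?opprB. Qed.

Lemma Rintegral_opp (d : measure_display) (T : measurableType d) (R : realType)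
    (mu : {measure set T -> \bar R}) (D : set T) (f : T -> R) :
  (\int[mu]_(x in D) (- f x) = - \int[mu]_(x in D) f x)%R.
Proof.
rewrite /Rintegral integralE [in RHS]integralE fine_sub_opp.
have -> : (fun x => (- f x)%:E) = (\- (fun x => (f x)%:E))%E by [].
by rewrite funeposN funenegN.
Qed.

Lemma Rintegral_eq0 (d : measure_display) (T : measurableType d) (R : realType)
    (mu : {measure set T -> \bar R}) (D : set T) (f : T -> R) :
  (forall x, f x = 0) -> (\int[mu]_(x in D) f x = 0)%R.
Proof.
move=> f0; rewrite /Rintegral (_ : (fun x => (f x)%:E) = cst 0%E) ?integral0//.
by apply/funext => x; rewrite f0.
Qed.

(** Swapping the arguments conjugates the integrand pointwise; [Rintegral_opp] carries the sign
    through the imaginary part. *)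
Lemma inner_conj (R : realType) (f h : R -> R[i]) :
  inner f h = (inner h f)^*%C.
Proof.
rewrite /inner /cintegral [RHS]/= -Rintegral_opp; congr Complex; congr Rintegral.
  by apply/funext => x; case: (f x) (h x) => [u v] [w z] /=; ring.
by apply/funext => x; case: (f x) (h x) => [u v] [w z] /=; ring.
Qed.

Lemma inner_eq0 (R : realType) (f h : R -> R[i]) :
  (forall x, f x = 0 \/ h x = 0) -> inner f h = 0.
Proof.
move=> fh0.
have E x : f x * (h x)^*%C = 0.
  by case: (fh0 x) => ->; rewrite ?mul0r// conjc0 mulr0.
by rewrite /inner /cintegral !Rintegral_eq0// => x; rewrite E.
Qed.

(** Each convolution with [box] widens the support by 1/2 on either side: a nonzero integrand at [t]
    needs |t| <= 1/2 and |x - t| within the previous radius. *)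
Lemma bspline_support (R : realType) (N : nat) (x : R) :
  (1 <= N)%N -> N%:R / 2 < `|x| -> bspline N x = 0.
Proof.
case: N => // N _; rewrite /bspline /=.
have box0 (y : R) : 2^-1 < `|y| -> box y = 0.
  move=> hy; rewrite /box indicE memNset//= in_itv/= => hy'.
  by move: hy; rewrite ltNge ler_norml hy'.
(* From here [N] counts convolutions, so the spline has order [N.+1] and radius [N.+1%:R / 2]. *)
elim: N x => [|N IH] x hx /=; first by apply: box0; lra.
apply: Rintegral_eq0 => t.
have [ht|ht] := ltP (2^-1) `|t|; first by rewrite box0// mul0r.
rewrite IH ?mulr0//.
have := ler_normB x t.
have := ler_normD (x - t) t; rewrite subrK.
by move: hx; rewrite -[N.+2%:R]natr1; lra.
Qed.

(** Moving the whole frequency difference onto the first atom yields a function of [j - j'], which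
    serves as the Toeplitz symbol. *)
Lemma inner_atom (R : realType) (g : R -> R) (a b j j' k k' : R) :
  inner (atom g a b j k) (atom g a b j' k') =
  inner (atom g a b (j - j') k) (atom g a b 0 k').
Proof.
congr cintegral; apply/funext => x; rewrite /atom /expi.
have -> : 2 * pi * (j - j') * b * x = 2 * pi * j * b * x - 2 * pi * j' * b * x.
  by ring.
rewrite cosB sinB !(mulr0, mul0r) cos0 sin0.
by apply/eqP; rewrite eq_complex /=; apply/andP; split; apply/eqP; ring.
Qed.

Lemma inner_atom_eq0 (R : realType) (g : R -> R) (r a b j j' k k' : R) :
  0 < a -> (forall x, r < `|x| -> g x = 0) -> 2 * r / a < `|k - k'| ->
  inner (atom g a b j k) (atom g a b j' k') = 0.
Proof.
move=> a0 g0; rewrite ltr_pdivrMr// => hk; apply: inner_eq0 => x.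
have [hx|hx] := ltP r `|x - k * a|; first by left; rewrite /atom g0// mul0r.
right; rewrite /atom g0 ?mul0r//.
(* The centres [k * a] and [k' * a] are more than [2 * r] apart and [x] is within [r] of the first,
   so it is farther than [r] from the second. *)
have := ler_normB (x - k' * a) (x - k * a).
rewrite (_ : _ - _ = (k - k') * a); last by ring.
by rewrite normrM (gtr0_norm a0); lra.
Qed.

Lemma gram_block_toeplitz (R : realType) (n : nat) (g : R -> R) (a b : R) :
  block_toeplitz (gram n g a b).
Proof.
split.
  (* The sign in the sesquilinear symmetry is [(-1) ^+ 0] in the Hermitian case. *)
  apply/is_hermitianmxP; rewrite expr0 scale1r.
  by apply/matrixP => s t; rewrite !mxE; exact: inner_conj.
exists (fun l => \matrix_(k < n, k' < n)
  inner (atom g a b l (cidx R k)) (atom g a b 0 (cidx R k'))) => j j'.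
by rewrite mxblockK; apply/matrixP => k k'; rewrite !mxE inner_atom.
Qed.

Theorem lemma3p2 (R : realType) (N : nat) (a b : R) (n : nat)
    (N_ge1 : (1 <= N)%N) (a_gt0 : 0 < a) (b_gt0 : 0 < b) (ab_lt1 : a * b < 1)
    (n_ge3 : (3 <= n)%N) (n_odd : odd n) (n_large : 2 / a + 1 < n%:R) :
  block_toeplitz (gram n (@bspline R N) a b) /\
  (forall j j' : 'I_n,
    banded (N%:R / a) (submxblock (gram n (@bspline R N) a b) j j')).
Proof.
split; first exact: gram_block_toeplitz.
move=> j j' k k' hk; rewrite mxblockK mxE.
(* The support radius N/2 of the spline turns [2 * r / a] into the bandwidth N/a. *)
apply: (@inner_atom_eq0 _ _ (N%:R / 2)) => // [x|]; first exact: bspline_support.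
by rewrite [2 * _]mulrC divfK ?pnatr_eq0.
Qed.
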